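(* Let $H$ be a Hilbert space, $J$ an index set, and let $K=(k_{ij})_{i,j\in J}$ and $L=(l_{ij})_{i,j\in J}$ be matrices with entries in $B(H)$ such that $K$ is row bounded and $L$ is column bounded. Then the Schur product $K*L=(k_{ij}l_{ij})_{i,j\in J}$ is bounded and $\|K*L\|\le\|K\|_r\,\|L\|_c$.
   Context: $M_J(B(H))$ is the set of all matrices $S=(s_{ij})_{i,j\in J}$ with entries $s_{ij}\in B(H)$. Such $S$ is bounded if it represents a bounded operator on $H\otimes\ell^2(J)$, and then $\|S\|$ is the norm of that operator. $S$ is row bounded if there is $C\ge0$ such that for all $i\in J$ and all finite $J_0\subseteq J$, $\big\|\sum_{j\in J_0}s_{ij}s_{ij}^*\big\|\le C^2$; the row norm $\|S\|_r$ is the least such $C$. $S$ is column bounded if there is $C\ge0$ such that for all $j\in J$ and all finite $J_0\subseteq J$, $\big\|\sum_{i\in J_0}s_{ij}^*s_{ij}\big\|\le C^2$; the column norm $\|S\|_c$ is the least such $C$. The Schur product of $K,L\in M_J(B(H))$ is $(K*L)_{ij}:=k_{ij}l_{ij}$ (product in $B(H)$). *)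

(* Defs.v *)
From HB Require Import structures.
From mathcomp Require Import all_boot all_order all_algebra finmap.
From mathcomp Require Import sesquilinear complex.
From mathcomp Require Import boolp classical_sets functions cardinality fsbigop.
From mathcomp Require Import reals constructive_ereal ereal topology normedtype.
From mathcomp Require Import sequences esum.
From mathcomp Require Import lra.

Set Implicit Arguments.
Unset Strict Implicit.
Unset Printing Implicit Defensive.

Import Order.TTheory GRing.Theory Num.Theory.
Import numFieldNormedType.Exports.

Local Open Scope classical_set_scope.
Local Open Scope ring_scope.
Local Open Scope complex_scope.

(* The norm of a normed module over R[i] takes values in R[i]. *)
Definition rnorm (R : realType) (V : normedModType R[i]) (x : V) : R :=
  complex.Re `|x|.

(* Complex Hilbert spaces; the inner product is linear in its first argument. *)
HB.mixin Record isHilbert (R : realType) H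
    & CompleteNormedModule R[i] H := {
  hdot : {dot H for (@Num.conj R[i])} ;
  sqr_normE : forall x : H, `|x| ^+ 2 = hdot x x
}.

#[short(type="hilbertType")]
HB.structure Definition Hilbert (R : realType) :=
  {H of CompleteNormedModule R[i] H & isHilbert R H}.

Lemma rnorm_ge0 (R : realType) (V : normedModType R[i]) (x : V) :
  0 <= rnorm x.
Proof. by have := normr_ge0 x; rewrite lecE => /andP[_]; rewrite raddf0. Qed.

Lemma rnormE (R : realType) (V : normedModType R[i]) (x : V) :
  `|x| = (rnorm x)%:C.
Proof.
rewrite /rnorm; have := normr_ge0 x; rewrite lecE /=; case: `|x| => a b /=.
by move=> /andP[/eqP-> _].
Qed.

Lemma rnormD (R : realType) (V : normedModType R[i]) (x y : V) :
  rnorm (x + y) <= rnorm x + rnorm y.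
Proof. by rewrite -lecR rmorphD /= -!rnormE ler_normD. Qed.

Lemma rnormZ (R : realType) (V : normedModType R[i]) (a : R[i]) (x : V) :
  rnorm (a *: x) = complex.Re `|a| * rnorm x.
Proof.
apply: (@complexI R); rewrite rmorphM /= -!rnormE normrZ; congr (_ * _).
Qed.

Section BoundedOperators.
Variable R : realType.

Section Space.
Variables V W : normedModType R[i].

Definition bop_pred : {pred V -> W} :=
  mem [set f : V -> W | linear f /\ continuous f].

Lemma bop_predP (f : V -> W) :
  reflect (linear f /\ continuous f) (f \in bop_pred).
Proof. by apply: (iffP idP); rewrite in_setE. Qed.

Fact bop_submod : submod_closed bop_pred.
Proof.
split=> [|a f g /bop_predP[lf cf] /bop_predP[lg cg]]; apply/bop_predP; split.
- by move=> a x y /=; rewrite scaler0 addr0.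
- by move=> x; exact: cst_continuous.
- move=> b x y.
  rewrite -[LHS]/(a *: f (b *: x + y) + g (b *: x + y)).
  rewrite -[RHS]/(b *: (a *: f x + g x) + (a *: f y + g y)).
  by rewrite lf lg !scalerDr !scalerA (mulrC a b) addrACA.
- by move=> x; apply: cvgD; [apply: cvgZ; [exact: cvg_cst|exact: cf]|exact: cg].
Qed.

HB.instance Definition _ := GRing.isSubmodClosed.Build R[i] (V -> W) bop_pred
  bop_submod.

Record bop := Bop { bop_fun :> V -> W ; bop_funP : bop_fun \in bop_pred }.

HB.instance Definition _ := [isSub for bop_fun].
HB.instance Definition _ := [Choice of bop by <:].
HB.instance Definition _ := [SubChoice_isSubLmodule of bop by <:].

Definition opnorm (T : bop) : R :=
  inf [set r : R | 0 <= r /\ forall x, rnorm (T x) <= r * rnorm x].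

End Space.

Lemma bop_comp_subproof (U V W : normedModType R[i]) (S : bop V W)
  (T : bop U V) : (S \o T : U -> W) \in @bop_pred U W.
Proof.
have /bop_predP[lS cS] := bop_funP S; have /bop_predP[lT cT] := bop_funP T.
apply/bop_predP; split=> [a x y /=|x]; first by rewrite lT lS.
by apply: continuous_comp; [exact: cT|exact: cS].
Qed.

Definition bop_comp (U V W : normedModType R[i]) (S : bop V W) (T : bop U V) :
  bop U W := Bop (bop_comp_subproof S T).

End BoundedOperators.

Section SquareSummable.
Variables (R : realType) (J : choiceType) (V : normedModType R[i]).

Definition l2_pred : {pred J -> V} :=
  mem [set x : J -> V | summable setT (fun j => (rnorm (x j) ^+ 2)%:E)].

Definition l2norm (x : J -> V) : R :=
  Num.sqrt (fine (\esum_(j in setT) (rnorm (x j) ^+ 2)%:E)).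

Let nrm (F : seq J) (x : J -> V) : R :=
  Num.sqrt (\sum_(j <- F) rnorm (x j) ^+ 2).

Let sum_ge0 (F : seq J) (x : J -> V) : 0 <= \sum_(j <- F) rnorm (x j) ^+ 2.
Proof. by apply: sumr_ge0 => j _; rewrite exprn_ge0 // rnorm_ge0. Qed.

Let minkowski2 (a b A B : R) :
  Num.sqrt ((a + b) ^+ 2 + (A + B) ^+ 2) <=
  Num.sqrt (a ^+ 2 + A ^+ 2) + Num.sqrt (b ^+ 2 + B ^+ 2).
Proof.
set p := Num.sqrt (a ^+ 2 + A ^+ 2); set q := Num.sqrt (b ^+ 2 + B ^+ 2).
have p0 : 0 <= p by exact: sqrtr_ge0.
have q0 : 0 <= q by exact: sqrtr_ge0.
have p2 : p ^+ 2 = a ^+ 2 + A ^+ 2 by rewrite sqr_sqrtr ?addr_ge0 ?sqr_ge0.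
have q2 : q ^+ 2 = b ^+ 2 + B ^+ 2 by rewrite sqr_sqrtr ?addr_ge0 ?sqr_ge0.
rewrite -[leRHS]ger0_norm ?addr_ge0// -sqrtr_sqr ler_wsqrtr//.
have : a * b + A * B <= p * q.
  apply: le_trans (ler_norm _) _.
  rewrite -ler_sqr ?nnegrE ?mulr_ge0// real_normK ?num_real//.
  rewrite [leRHS]exprMn p2 q2.
  by have := sqr_ge0 (a * B - A * b); lra.
by rewrite (sqrrD p) p2 q2 => h; rewrite !sqrrD; lra.
Qed.

Let nrmD (F : seq J) (x y : J -> V) : nrm F (x + y) <= nrm F x + nrm F y.
Proof.
rewrite /nrm; elim: F => [|j F IH]; first by rewrite !big_nil sqrtr0 addr0.
rewrite !big_cons; apply: le_trans _ (_ : Num.sqrt ((rnorm (x j) + rnorm (y j)) ^+ 2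
  + (nrm F x + nrm F y) ^+ 2) <= _).
  rewrite ler_wsqrtr// lerD//.
    by rewrite ler_sqr ?nnegrE ?addr_ge0 ?rnorm_ge0// rnormD.
  rewrite -[leLHS]sqr_sqrtr ?sum_ge0// ler_sqr ?nnegrE ?sqrtr_ge0//.
  by rewrite addr_ge0 ?sqrtr_ge0.
apply: le_trans (minkowski2 _ _ _ _) _.
by rewrite /nrm !sqr_sqrtr ?sum_ge0.
Qed.

Let nrmZ (F : seq J) (a : R[i]) (x : J -> V) :
  nrm F (a *: x) = complex.Re `|a| * nrm F x.
Proof.
rewrite /nrm -[X in X * _]ger0_norm; last first.
  by have := normr_ge0 a; rewrite lecE => /andP[].
rewrite -sqrtr_sqr -sqrtrM ?sqr_ge0// mulr_sumr; congr Num.sqrt.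
by apply: eq_bigr => j _; rewrite rnormZ exprMn.
Qed.

Let sqn (x : J -> V) (j : J) : \bar R := (rnorm (x j) ^+ 2)%:E.

Let sqn_ge0 x j : (0 <= sqn x j)%E.
Proof. by rewrite lee_fin sqr_ge0. Qed.

Lemma l2_predP (x : J -> V) :
  reflect (\esum_(j in setT) (rnorm (x j) ^+ 2)%:E < +oo)%E (x \in l2_pred).
Proof.
apply: (iffP idP); rewrite in_setE /= /summable => h.
  by apply: le_lt_trans h; apply: le_esum => j _; exact: lee_abs.
by rewrite (eq_esum (fun j _ => gee0_abs (sqn_ge0 x j))).
Qed.

Lemma l2norm_ge0 (x : J -> V) : 0 <= l2norm x.
Proof. exact: sqrtr_ge0. Qed.

Lemma le_l2norm (x : J -> V) (F : {fset J}) : x \in l2_pred ->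
  Num.sqrt (\sum_(j <- F) rnorm (x j) ^+ 2) <= l2norm x.
Proof.
move=> /l2_predP fx; rewrite ler_wsqrtr// -lee_fin fineK; last first.
  by rewrite ge0_fin_numE// esum_ge0// => j _; exact: sqn_ge0.
apply: esum_ge; exists [set` F]; first by split.
by rewrite fsbig_finite//= set_fsetK sumEFin.
Qed.

Lemma l2_bound (x : J -> V) (M : R) : 0 <= M ->
  (forall F : {fset J}, Num.sqrt (\sum_(j <- F) rnorm (x j) ^+ 2) <= M) ->
  x \in l2_pred /\ l2norm x <= M.
Proof.
move=> M0 hF; set S := (\esum_(j in setT) (rnorm (x j) ^+ 2)%:E)%E.
have SM : (S <= (M ^+ 2)%:E)%E.
  apply: ub_ereal_sup => _ [A [finA _] <-].
  rewrite fsbig_finite//= sumEFin lee_fin -[leLHS]sqr_sqrtr ?sum_ge0//.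
  by rewrite ler_sqr ?nnegrE ?sqrtr_ge0.
have Sfin : (S < +oo)%E by apply: le_lt_trans SM (ltry _).
split; first exact/l2_predP.
rewrite -[leRHS]ger0_norm// -sqrtr_sqr ler_wsqrtr// -lee_fin fineK//.
by rewrite ge0_fin_numE// esum_ge0// => j _; exact: sqn_ge0.
Qed.

Lemma l2_add (x y : J -> V) : x \in l2_pred -> y \in l2_pred ->
  x + y \in l2_pred /\ l2norm (x + y) <= l2norm x + l2norm y.
Proof.
move=> lx ly; apply: l2_bound => [|F]; first by rewrite addr_ge0 ?l2norm_ge0.
by apply: le_trans (nrmD F x y) _; rewrite lerD ?le_l2norm.
Qed.

Lemma l2_scale (a : R[i]) (x : J -> V) : x \in l2_pred ->
  a *: x \in l2_pred /\ l2norm (a *: x) <= complex.Re `|a| * l2norm x.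
Proof.
have a0 : 0 <= complex.Re `|a|.
  by have := normr_ge0 a; rewrite lecE => /andP[].
move=> lx; apply: l2_bound => [|F]; first by rewrite mulr_ge0 ?l2norm_ge0.
by rewrite -/(nrm F (a *: x)) nrmZ ler_wpM2l// le_l2norm.
Qed.

Lemma l2_zero : (0 : J -> V) \in l2_pred /\ l2norm 0 <= 0.
Proof.
apply: l2_bound => // F; rewrite big1 ?sqrtr0// => j _.
by rewrite /rnorm normr0 expr0n.
Qed.

Fact l2_submod : submod_closed l2_pred.
Proof.
split=> [|a x y lx ly]; first by have [] := l2_zero.
by apply: (l2_add _ ly).1; exact: (l2_scale a lx).1.
Qed.

HB.instance Definition _ := GRing.isSubmodClosed.Build R[i] (J -> V) l2_pred
  l2_submod.

Record l2 := L2 { l2_fun :> J -> V ; l2_funP : l2_fun \in l2_pred }.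

HB.instance Definition _ := [isSub for l2_fun].
HB.instance Definition _ := [Choice of l2 by <:].
HB.instance Definition _ := [SubChoice_isSubLmodule of l2 by <:].

Fact l2_normD (x y : l2) :
  (l2norm (x + y : l2))%:C <= (l2norm x)%:C + (l2norm y)%:C.
Proof. by rewrite -rmorphD lecR; exact: (l2_add (l2_funP x) (l2_funP y)).2. Qed.

Fact l2_normZ (a : R[i]) (x : l2) :
  (l2norm (a *: x : l2))%:C = `|a| * (l2norm x)%:C.
Proof.
have aE : `|a| = (complex.Re `|a|)%:C.
  by have := normr_ge0 a; rewrite lecE; case: `|a| => u v /= /andP[/eqP-> _].
rewrite aE -rmorphM; congr (_%:C); apply/le_anti/andP; split.
  exact: (l2_scale a (l2_funP x)).2.
have [->|a0] := eqVneq a 0; first by rewrite normr0 mul0r l2norm_ge0.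
have ax : a^-1 *: l2_fun (a *: x) = x :> (J -> V).
  by rewrite /= scalerA mulVf// scale1r.
have := (l2_scale a^-1 (l2_funP (a *: x))).2; rewrite ax.
rewrite normfV aE -fmorphV /= => h.
rewrite -ler_pdivlMl//.
have : 0 < `|a| by rewrite normr_gt0.
by rewrite aE ltcR.
Qed.

Fact l2_norm0_eq0 (x : l2) : (l2norm x)%:C = 0 -> x = 0.
Proof.
move=> /(@complexI R) x0; apply: val_inj; apply/funext => j /=.
apply/normr0_eq0; rewrite rnormE; congr (_%:C); apply/le_anti.
rewrite rnorm_ge0 andbT -x0; apply: le_trans _ (le_l2norm [fset j]%fset (l2_funP x)).
by rewrite big_seq_fset1 sqrtr_sqr ger0_norm ?rnorm_ge0.
Qed.

HB.instance Definition _ := @Lmodule_isNormed.Build R[i] l2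
  (fun x => (l2norm x)%:C) l2_normD l2_normZ l2_norm0_eq0.

Fact l2_single_subproof (j : J) (v : V) :
  (fun i => if i == j then v else 0) \in l2_pred.
Proof.
apply: (@l2_bound _ (rnorm v) _ _).1 => [|F]; first exact: rnorm_ge0.
have [jF|jF] := boolP (j \in F).
  rewrite (big_fsetD1 j)//= eqxx big_seq big1 ?addr0.
    by rewrite sqrtr_sqr ger0_norm ?rnorm_ge0.
  by move=> i; rewrite !inE => /andP[/negPf-> _]; rewrite /rnorm normr0 expr0n.
rewrite big_seq big1 ?sqrtr0 ?rnorm_ge0// => i iF; case: eqP => [ij|_].
  by rewrite -ij iF in jF.
by rewrite /rnorm normr0 expr0n.
Qed.

Definition l2_single (j : J) (v : V) : l2 := L2 (l2_single_subproof j v).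

End SquareSummable.

Section OperatorMatrices.
Variables (R : realType) (H : hilbertType R) (J : choiceType).

(* The default value 0 is never used: T^* exists for every T in B(H) by the
   Riesz representation theorem, and it is unique. *)
Definition adjoint (T : bop H H) : bop H H :=
  xget 0 [set T' : bop H H |
    forall x y : H, hdot (T x) y = hdot x (T' y)].

Implicit Types S K L : J -> J -> bop H H.

(* The Hilbert space tensor product of H and l^2(J) is identified with the
   space l2 J H of square-summable families in H, v (x) delta_j being the family
   l2_single j v; the (i, j) entry of an operator T on it is therefore
   v |-> (T (v (x) delta_j))_i. *)
Definition represents S (T : bop (l2 J H) (l2 J H)) : Prop :=
  forall (i j : J) (v : H), T (l2_single j v) i = S i j v.

Definition mx_bounded S : Prop := exists T, represents S T.

(* The operator represented by a bounded matrix is unique, since the span of the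
   families l2_single j v is dense; mx_op is 0 on an unbounded matrix. *)
Definition mx_op S : bop (l2 J H) (l2 J H) := xget 0 (represents S).

Definition mx_norm S : R := opnorm (mx_op S).

Definition row_bound S (C : R) : Prop :=
  0 <= C /\ forall (i : J) (J0 : {fset J}),
    opnorm (\sum_(j <- J0) bop_comp (S i j) (adjoint (S i j))) <= C ^+ 2.

Definition row_bounded S : Prop := exists C, row_bound S C.

Definition row_norm S : R := inf [set C | row_bound S C].

Definition col_bound S (C : R) : Prop :=
  0 <= C /\ forall (j : J) (J0 : {fset J}),
    opnorm (\sum_(i <- J0) bop_comp (adjoint (S i j)) (S i j)) <= C ^+ 2.

Definition col_bounded S : Prop := exists C, col_bound S C.

Definition col_norm S : R := inf [set C | col_bound S C].

Definition schur_mul K L : J -> J -> bop H H :=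
  fun i j => bop_comp (K i j) (L i j).

End OperatorMatrices.

(* Main.v *)
(* Riesz' theorem gives every bounded operator its adjoint.  For z in l^2(J, H) and y
   the sum of the k_ij z_j over a finite F, Cauchy-Schwarz applied to
   |y|^2 = sum_j <z_j, k_ij^* y> and the row bound on K yield
   |y|^2 <= |K|_r^2 sum_(j in F) |z_j|^2.  Taking z_j = l_ij x_j and summing over i,
   the column bound on L gives |(K * L) x| <= |K|_r |L|_c |x| for finitely supported
   x.  The same estimate on tails makes the rows of K * L unconditionally summable
   against any x in l^2(J, H), which defines the operator. *)
From HB Require Import structures.
From mathcomp Require Import all_boot all_order all_algebra finmap.
From mathcomp Require Import sesquilinear complex.
From mathcomp Require Import boolp classical_sets functions reals topology.
From mathcomp Require Import normedtype summability.
From mathcomp Require Import ring lra.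
Require Import Defs.

Set Implicit Arguments.
Unset Strict Implicit.
Unset Printing Implicit Defensive.

Import Order.TTheory GRing.Theory Num.Theory.
Import numFieldNormedType.Exports.

Local Open Scope classical_set_scope.
Local Open Scope ring_scope.
Local Open Scope complex_scope.

#[local] Existing Instance totally_filter.

(** * Bounded operators between normed spaces and the operator norm *)

Section Functionals.
Variable R : realType.

Lemma bop_linear (V W : normedModType R[i]) (T : bop V W) : linear T.
Proof. by have /bop_predP[] := bop_funP T. Qed.

Lemma bop_continuous (V W : normedModType R[i]) (T : bop V W) : continuous T.
Proof. by have /bop_predP[] := bop_funP T. Qed.

HB.instance Definition _ (V W : normedModType R[i]) (T : bop V W) :=
  GRing.isLinear.Build R[i] V W *:%R T (bop_linear T).

Lemma rnorm0 (V : normedModType R[i]) : rnorm (0 : V) = 0.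
Proof. by rewrite /rnorm normr0. Qed.

Lemma rnorm0_eq0 (V : normedModType R[i]) (x : V) : rnorm x = 0 -> x = 0.
Proof. by move=> x0; apply: normr0_eq0; rewrite rnormE x0. Qed.

Lemma rnormN (V : normedModType R[i]) (x : V) : rnorm (- x) = rnorm x.
Proof. by rewrite /rnorm normrN. Qed.

Lemma rnormB (V : normedModType R[i]) (x y : V) : rnorm (x - y) = rnorm (y - x).
Proof. by rewrite -rnormN opprB. Qed.

Lemma rnormZr (V : normedModType R[i]) (t : R) (x : V) :
  rnorm (t%:C *: x) = `|t| * rnorm x.
Proof. by rewrite rnormZ normc_def /= expr0n addr0 sqrtr_sqr. Qed.

Lemma ltcR_pos (e : R[i]) : 0 < e -> exists2 r : R, 0 < r & e = r%:C.
Proof.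
case: e => a b; rewrite ltcE /= => /andP[/eqP-> a0].
by exists a.
Qed.

Lemma cvg_rnormP (T : Type) (V : normedModType R[i]) (F : set_system T)
    {FF : Filter F} (f : T -> V) (l : V) :
  f @ F --> l <-> forall e : R, 0 < e -> \forall t \near F, rnorm (l - f t) < e.
Proof.
split=> [/cvgrPdist_lt h e e0|h].
  have /h : 0 < e%:C by rewrite ltcR.
  by apply: filterS => t; rewrite rnormE ltcR.
apply/cvgrPdist_lt => _ /ltcR_pos[e /h he ->].
by apply: filterS he => t; rewrite rnormE ltcR.
Qed.

Lemma cvg_rnorm (T : Type) (V : normedModType R[i]) (F : set_system T)
    {FF : Filter F} (f : T -> V) (l : V) :
  f @ F --> l -> (fun t => rnorm (f t)) @ F --> rnorm l.
Proof.
move=> /cvg_rnormP h; apply/cvgrPdist_lt => e /h; apply: filterS => t.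
apply: le_lt_trans; rewrite ler_norml; apply/andP; split.
  by have := rnormD (f t - l) l; rewrite subrK rnormB; lra.
by have := rnormD (l - f t) (f t); rewrite subrK; lra.
Qed.

Lemma cauchy_rnorm_cvg (V : completeNormedModType R[i]) (F : set_system V)
    {FF : ProperFilter F} :
  (forall e : R, 0 < e -> exists x, \forall y \near F, rnorm (x - y) < e) ->
  cvg F.
Proof.
move=> h; apply: cauchy_cvg; apply: cauchy_exP => _ /ltcR_pos[e /h [x hx] ->].
exists x; apply: filterS hx => y; rewrite -ball_normE /=.
by rewrite rnormE ltcR.
Qed.

Lemma bop_bounded (V W : normedModType R[i]) (T : bop V W) :
  exists2 M : R, 0 <= M & forall x, rnorm (T x) <= M * rnorm x.
Proof.
have /cvg_rnormP /(_ _ (@ltr01 R)) := @bop_continuous _ _ T 0.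
rewrite linear0 => /nbhs_ballP[_ /= /ltcR_pos[d d0 ->]].
rewrite -ball_normE => hd.
exists (2 / d) => [|x]; first by rewrite divr_ge0 // ltW.
have [->|x0] := eqVneq x 0; first by rewrite linear0 !rnorm0 mulr0.
have nx : 0 < rnorm x.
  by rewrite lt_neqAle rnorm_ge0 andbT eq_sym; apply: contra_neq x0; exact: rnorm0_eq0.
(* [t] rescales [x] to norm [d / 2], inside the ball that continuity at 0 sends into the unit ball;
   hence the constant [2 / d]. *)
pose t := d / 2 / rnorm x.
have t0 : 0 < t by rewrite divr_gt0// divr_gt0.
have /hd /= : `|0 - t%:C *: x| < d%:C.
  rewrite sub0r normrN rnormE ltcR rnormZr gtr0_norm// /t.
  by rewrite divfK ?gt_eqF//; lra.
rewrite sub0r rnormN linearZ /= rnormZr gtr0_norm// => /ltW h.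
have -> : 2 / d * rnorm x = t^-1 by rewrite /t; field; rewrite !gt_eqF.
by rewrite -[leRHS]mul1r ler_pdivlMr// mulrC.
Qed.

Lemma bounded_bop_pred (V W : normedModType R[i]) (f : V -> W) (M : R) :
  linear f -> (forall x, rnorm (f x) <= M * rnorm x) -> f \in @bop_pred R V W.
Proof.
move=> lf hM; apply/bop_predP; split=> // x; apply/cvg_rnormP => e e0.
have fB y : f x - f y = f (x - y).
  by rewrite -scaleN1r addrC -lf scaleN1r addrC.
(* [M] may be zero or negative, so [e] is divided by a constant that is positive in every case. *)
have M1 : 0 < `|M| + 1 by rewrite ltr_wpDl.
have /cvg_rnormP /(_ (e / (`|M| + 1))) : id @ x --> x by [].
rewrite divr_gt0// => /(_ isT); apply: filterS => y.
rewrite ltr_pdivlMr// fB; apply: le_lt_trans; apply: le_trans (hM _) _.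
rewrite mulrC ler_wpM2l ?rnorm_ge0//.
by apply: le_trans (ler_norm _) _; lra.
Qed.

(** The infimum defining [opnorm] is attained: for nonzero [x] the quotient [rnorm (T x) / rnorm x]
    is a lower bound of a set that [bop_bounded] shows to be nonempty. *)
Lemma rnorm_bop_le (V W : normedModType R[i]) (T : bop V W) (x : V) :
  rnorm (T x) <= opnorm T * rnorm x.
Proof.
have [->|x0] := eqVneq x 0; first by rewrite linear0 !rnorm0 mulr0.
have nx : 0 < rnorm x.
  by rewrite lt_neqAle rnorm_ge0 andbT eq_sym; apply: contra_neq x0; exact: rnorm0_eq0.
rewrite -ler_pdivrMr//; apply: lb_le_inf.
  by have [M M0 hM] := bop_bounded T; exists M.
by move=> r [r0 hr]; rewrite ler_pdivrMr.
Qed.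

Lemma opnorm_le (V W : normedModType R[i]) (T : bop V W) (r : R) :
  0 <= r -> (forall x, rnorm (T x) <= r * rnorm x) -> opnorm T <= r.
Proof. by move=> r0 hr; apply: ge_inf; [exists 0 => s []|split]. Qed.

Lemma bop_sumE (V W : normedModType R[i]) (I : Type) (s : seq I)
    (T : I -> bop V W) (x : V) : (\sum_(i <- s) T i) x = \sum_(i <- s) T i x.
Proof.
elim: s => [|i s IH]; first by rewrite !big_nil.
by rewrite !big_cons -IH.
Qed.

End Functionals.

(** * Real inner product, Riesz representation and adjoints *)

Section InnerProduct.
Variables (R : realType) (H : hilbertType R).
Implicit Types (x y z : H) (t : R).

(** The underlying real Hilbert space has the same norm, and minimisation arguments need an ordered
    scalar field. *)
Definition rdot x y : R := complex.Re (hdot x y).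

Lemma rdotxx x : rdot x x = rnorm x ^+ 2.
Proof.
by rewrite /rdot -sqr_normE rnormE expr2 /= mulr0 subr0 -expr2.
Qed.

Lemma rdotDl x y z : rdot (x + y) z = rdot x z + rdot y z.
Proof. by rewrite /rdot linearDl raddfD. Qed.

Lemma rdotC x y : rdot x y = rdot y x.
Proof.
have ReJ (a : R[i]) : complex.Re (Num.conj a) = complex.Re a by case: a.
by rewrite /rdot hermC expr0 mul1r; exact: ReJ.
Qed.

Lemma rdotDr x y z : rdot z (x + y) = rdot z x + rdot z y.
Proof. by rewrite rdotC rdotDl !(rdotC z). Qed.

Lemma rdotZl t x y : rdot (t%:C *: x) y = t * rdot x y.
Proof.
by rewrite /rdot linearZl_LR /=; case: (hdot x y) => a b /=; rewrite mul0r subr0.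
Qed.

Lemma rdotZr t x y : rdot y (t%:C *: x) = t * rdot y x.
Proof. by rewrite rdotC rdotZl rdotC. Qed.

Let opp_scaleC x : - x = (-1)%:C *: x.
Proof. by rewrite rmorphN1 scaleN1r. Qed.

Lemma rdotNl x y : rdot (- x) y = - rdot x y.
Proof. by rewrite opp_scaleC rdotZl mulN1r. Qed.

Lemma rdotNr x y : rdot y (- x) = - rdot y x.
Proof. by rewrite rdotC rdotNl rdotC. Qed.

Lemma rdot0l x : rdot 0 x = 0.
Proof. by rewrite /rdot linear0l. Qed.

Lemma rdot_suml (I : Type) (s : seq I) (u : I -> H) y :
  rdot (\sum_(i <- s) u i) y = \sum_(i <- s) rdot (u i) y.
Proof.
by elim/big_rec2: _ => [|i a b _ <-]; rewrite ?rdot0l ?rdotDl.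
Qed.

(** Cauchy-Schwarz, from expanding the squared norm of |y| x - |x| y; cancelling |x| |y| at the end
    requires both vectors to be nonzero. *)
Lemma rdot_rnorm x y : rdot x y <= rnorm x * rnorm y.
Proof.
have x0 := rnorm_ge0 x; have y0 := rnorm_ge0 y.
have [y00|yn0] := eqVneq (rnorm y) 0.
  by rewrite (rnorm0_eq0 y00) rdotC rdot0l mulr_ge0// rnorm0.
have [x00|xn0] := eqVneq (rnorm x) 0.
  by rewrite (rnorm0_eq0 x00) rdot0l rnorm0 mul0r.
have xy0 : 0 < rnorm x * rnorm y by rewrite mulr_gt0// lt_neqAle eq_sym ?xn0 ?yn0.
have := sqr_ge0 (rnorm ((rnorm y)%:C *: x - (rnorm x)%:C *: y)).
rewrite -rdotxx !(rdotDl, rdotDr, rdotNl, rdotNr, rdotZl, rdotZr) !rdotxx (rdotC y x).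
set a := rnorm x in xy0 *; set b := rnorm y in xy0 *; move=> h.
have : 0 <= 2 * (a * b) * (a * b - rdot x y) by apply: le_trans h _; lra.
by rewrite pmulr_rge0 ?subr_ge0// mulr_gt0.
Qed.

Lemma rdot_inj x y : (forall z, rdot z x = rdot z y) -> x = y.
Proof.
move=> h; apply/eqP; rewrite -subr_eq0; apply/eqP/rnorm0_eq0/eqP.
by rewrite -sqrf_eq0 -rdotxx rdotDr rdotNr h subrr.
Qed.

(** The scalars 1 and i recover the real and imaginary parts of [hdot] from [rdot]. *)
Lemma rdot_hdot x y x' y' :
  (forall a : R[i], rdot (a *: x) y = rdot (a *: x') y') -> hdot x y = hdot x' y'.
Proof.
move=> h; apply/eqP; rewrite eq_complex; have := h 1; rewrite /rdot !scale1r => ->.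
have := h 'i%C; rewrite /rdot !linearZl_LR /=.
case: (hdot x y) => a b; case: (hdot x' y') => c d /=.
by rewrite !mul0r !mul1r !sub0r eqxx => /oppr_inj ->; rewrite eqxx.
Qed.

(* The representing vector minimises |x|^2 - 2 g x; by the parallelogram law every
   minimising family is Cauchy. *)
Lemma riesz (g : H -> R) (M : R) :
  (forall x y, g (x + y) = g x + g y) -> (forall t x, g (t%:C *: x) = t * g x) ->
  (forall x, g x <= M * rnorm x) ->
  exists z, forall x, rdot x z = g x.
Proof.
move=> gD gZ gM.
have gN x : g (- x) = - g x.
  by rewrite opp_scaleC gZ mulN1r.
pose p x := rnorm x ^+ 2 - 2 * g x.
pose m := inf (range p).
have pm x : m <= p x.
  apply: ge_inf; last by exists x.
  (* Completing the square: |y|^2 - 2 M |y| is at least -M^2. *)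
  exists (- M ^+ 2) => _ [y _ <-]; rewrite /p.
  by have := gM y; have := sqr_ge0 (rnorm y - M); rewrite sqrrB; lra.
pose F := filter_from [set e : R | 0 < e] (fun e => [set x | p x < m + e]).
have FF : ProperFilter F.
  apply: filter_from_proper => [|e e0].
    apply: filter_from_filter; first by exists 1 => /=.
    move=> a b /= a0 b0; exists (Num.min a b); first by rewrite /= lt_min a0.
    move=> x /= px; split; apply: lt_le_trans px _; rewrite lerD2l.
      by rewrite ge_min lexx.
    by rewrite ge_min lexx orbT.
  have [|_ [x _ <-] xe] := @inf_adherent _ (range p) e e0; last by exists x.
  by split; [exists (p 0), 0|exists m => _ [y _ <-]; exact: pm].
have Fp e : 0 < e -> \forall x \near F, p x < m + e by move=> e0; exists e.
(* Parallelogram law, with [m] bounding [p] from below at the midpoint of [x] and [y]. *)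
have para x y : rnorm (x - y) ^+ 2 <= 2 * (p x + p y - 2 * m).
  have := pm ((2^-1)%:C *: (x + y)); rewrite /p gZ gD -!rdotxx.
  rewrite !(rdotDl, rdotDr, rdotNl, rdotNr, rdotZl, rdotZr) (rdotC y x).
  lra.
have /cvg_ex[z Fcz] : cvg F.
  apply: cauchy_rnorm_cvg => e e0.
  (* By [para], two points whose [p]-values are below [m + e ^+ 2 / 4] are less than [e] apart. *)
  have e4 : 0 < e ^+ 2 / 4 by rewrite divr_gt0// exprn_gt0.
  have [x xe] := filter_ex (Fp _ e4).
  exists x; apply: filterS (Fp _ e4) => y ye.
  rewrite -ltr_sqr ?nnegrE ?rnorm_ge0 ?ltW//.
  by apply: le_lt_trans (para _ _) _; lra.
have Fz : forall e : R, 0 < e -> \forall x \near F, rnorm (z - x) < e.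
  exact: (cvg_rnormP (id : H -> H) z).1 Fcz.
(* Minimality of [z] compared with [z + h]. That [p z] does not exceed [m] follows by approximating
   [z] along [F]. *)
have pz h : 0 <= rnorm h ^+ 2 + 2 * (rdot z h - g h).
  suff pzm : p z <= m.
    apply: (@le_trans _ _ (p (z + h) - p z)).
      by rewrite subr_ge0 (le_trans pzm).
    by rewrite /p gD -!rdotxx !(rdotDl, rdotDr) (rdotC h z); lra.
  apply/ler_addgt0Pr => e e0.
  (* One-sided Lipschitz constant for [p z - p x], with Cauchy-Schwarz bounding the inner product
     and [gM] bounding [g]; the summand 1 keeps it positive. *)
  pose N := 2 * (rnorm z + `|M| + 1).
  have N0 : 0 < N by rewrite /N; have := rnorm_ge0 z; have := normr_ge0 M; lra.
  have d0 : 0 < e / 2 / N by rewrite divr_gt0// divr_gt0.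
  have e2 : 0 < e / 2 by rewrite divr_gt0.
  have [x [xz xe]] := filter_ex (filterI (Fz _ d0) (Fp _ e2)).
  have : p z - p x <= N * rnorm (z - x).
    have -> : p z - p x =
        2 * rdot (z - x) z - rnorm (z - x) ^+ 2 - 2 * g (z - x).
      by rewrite /p gD gN -!rdotxx !(rdotDl, rdotDr, rdotNl, rdotNr) (rdotC x z); lra.
    have gzx : - g (z - x) <= `|M| * rnorm (z - x).
      rewrite -gN -(rnormN (z - x)); apply: le_trans (gM _) _.
      by rewrite ler_wpM2r ?rnorm_ge0// ler_norm.
    have := rdot_rnorm (z - x) z; have := sqr_ge0 (rnorm (z - x)).
    have := rnorm_ge0 (z - x).
    by rewrite /N; lra.
  by move: xz; rewrite ltr_pdivlMr// mulrC; move: xe; lra.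
exists z => x; rewrite rdotC; apply/eqP; rewrite -subr_eq0; apply/eqP.
set c := rdot z x - g x.
have hc t : 0 <= t ^+ 2 * rnorm x ^+ 2 + 2 * t * c.
  have := pz (t%:C *: x); rewrite rnormZr rdotZr gZ exprMn real_normK ?num_real//.
  by rewrite /c; lra.
have q0 : 0 < rnorm x ^+ 2 + 1 by have := sqr_ge0 (rnorm x); lra.
(* This [t] turns the quadratic into a negative multiple of [c ^+ 2], forcing [c = 0]; the
   denominator stays positive even for [x = 0]. *)
have := hc (- c / (rnorm x ^+ 2 + 1)); set q := rnorm x ^+ 2 in q0 *.
have -> : (- c / (q + 1)) ^+ 2 * q + 2 * (- c / (q + 1)) * c =
          - (c ^+ 2 * ((q + 2) / (q + 1) ^+ 2)) by field; rewrite gt_eqF.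
rewrite oppr_ge0 pmulr_lle0; last first.
  by rewrite divr_gt0 ?exprn_gt0//; lra.
by move=> c0; apply/eqP; rewrite -sqrf_eq0 eq_le c0 sqr_ge0.
Qed.

(** Riesz applied to [rdot (T x) y0] gives the value at each [y0]. Uniqueness of representing
    vectors makes the choice linear, testing against [f v] itself bounds it, and so the default of
    [xget] is excluded. *)
Lemma adjointP (T : bop H H) x y : hdot (T x) y = hdot x (adjoint T y).
Proof.
suff [T' hT'] : [set T' : bop H H | forall x y : H, hdot (T x) y = hdot x (T' y)] !=set0.
  by rewrite /adjoint; case: xgetP => [T1 -> /= ->//|/(_ T')].
have [M M0 hM] := bop_bounded T.
have /choice[f hf] y0 : exists z, forall x, rdot x z = rdot (T x) y0.
  apply: (@riesz _ (M * rnorm y0)) => [u v|t u|u].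
  - by rewrite linearD rdotDl.
  - by rewrite linearZ /= rdotZl.
  - apply: le_trans (rdot_rnorm _ _) _.
    by rewrite mulrAC ler_wpM2r ?rnorm_ge0.
have hdf u v : hdot (T u) v = hdot u (f v).
  by apply: rdot_hdot => a; rewrite hf linearZ.
have lf : linear f.
  move=> a u v; apply: rdot_inj => z; rewrite rdotDr !hf rdotDr; congr (_ + _).
  rewrite /rdot; congr complex.Re; rewrite !linearZr_LR /=; congr (_ * _).
  exact: hdf.
have fM v : rnorm (f v) <= M * rnorm v.
  have [->|v0] := eqVneq (rnorm (f v)) 0; first by rewrite mulr_ge0// rnorm_ge0.
  have fv0 : 0 < rnorm (f v) by rewrite lt_neqAle eq_sym v0 rnorm_ge0.
  rewrite -(ler_pM2r fv0) -expr2 -rdotxx hf; apply: le_trans (rdot_rnorm _ _) _.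
  by rewrite mulrAC ler_wpM2r ?rnorm_ge0.
by exists (Bop (bounded_bop_pred lf fM)).
Qed.

Lemma rdot_adjoint (T : bop H H) x y : rdot (T x) y = rdot x (adjoint T y).
Proof. by rewrite /rdot adjointP. Qed.

End InnerProduct.

(** * Finite partial sums and their tails *)

Section FiniteSums.
Variables (R : realType) (J : choiceType).

Lemma big_fset_split (V : zmodType) (A B : {fset J}) (u : J -> V) :
  (A `<=` B)%fset ->
  \sum_(j <- B) u j = \sum_(j <- A) u j + \sum_(j <- (B `\` A)%fset) u j.
Proof.
move=> /fsubsetP AB; rewrite (big_fsetID _ (mem A)); congr (_ + _).
  congr (\sum_(j <- enum_fset _) _); apply/fsetP => j; rewrite !inE /=.
  by apply/andP/idP => [[]//|jA]; split=> //; exact: AB.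
by congr (\sum_(j <- enum_fset _) _); apply/fsetP => j; rewrite !inE /= andbC.
Qed.

(** Once the sum over [F0] is within [e] of the supremum of all finite sums, indices outside a
    larger [F] can add less than [e]. *)
Lemma summable_tail (a : J -> R) (M : R) : (forall j, 0 <= a j) ->
  (forall F : {fset J}, \sum_(j <- F) a j <= M) ->
  forall e, 0 < e -> exists F0 : {fset J}, forall F G : {fset J},
    (F0 `<=` F)%fset -> \sum_(j <- (G `\` F)%fset) a j < e.
Proof.
move=> a0 aM e e0; pose E := range (fun F : {fset J} => \sum_(j <- F) a j).
have supE : has_sup E.
  split; first by exists (\sum_(j <- fset0) a j), fset0.
  by exists M => _ [F _ <-].
have [_ [F0 _ <-] he] := sup_adherent e0 supE.
exists F0 => F G F0F.
have : \sum_(j <- (F `|` G)%fset) a j <= sup E.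
  by apply: ub_le_sup; [exact: supE.2|exists (F `|` G)%fset].
rewrite (big_fset_split _ (fsubsetUl F G)) fsetDUl fsetDv fset0U.
rewrite (big_fset_split _ F0F).
have : 0 <= \sum_(j <- (F `\` F0)%fset) a j by exact: sumr_ge0.
by lra.
Qed.

(** [totally] is the filter of finite subsets directed by inclusion; convergence of partial sums
    along it is unconditional summability. *)
Lemma near_totally (F0 : {fset J}) : \forall F \near totally, (F0 `<=` F)%fset.
Proof. by exists F0. Qed.

End FiniteSums.

(** * Square-summable families and their truncations *)

Section L2.
Variables (R : realType) (J : choiceType) (V : normedModType R[i]).
Implicit Type x : l2 J V.

Lemma sum_le_l2norm x (F : {fset J}) :
  \sum_(j <- F) rnorm (x j) ^+ 2 <= rnorm x ^+ 2.
Proof.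
have s0 : 0 <= \sum_(j <- F) rnorm (x j) ^+ 2.
  by apply: sumr_ge0 => j _; exact: sqr_ge0.
rewrite -[leLHS](sqr_sqrtr s0) ler_sqr ?nnegrE ?sqrtr_ge0 ?rnorm_ge0//.
exact: le_l2norm (l2_funP x).
Qed.

Lemma l2_bound_sqr (u : J -> V) (M : R) : 0 <= M ->
  (forall F : {fset J}, \sum_(j <- F) rnorm (u j) ^+ 2 <= M ^+ 2) ->
  u \in @l2_pred R J V /\ l2norm u <= M.
Proof.
move=> M0 uM; apply: l2_bound => // F.
by rewrite -[leRHS]ger0_norm// -sqrtr_sqr ler_wsqrtr.
Qed.

Lemma rnorm_l2_le x (M : R) : 0 <= M ->
  (forall F : {fset J}, \sum_(j <- F) rnorm (x j) ^+ 2 <= M ^+ 2) -> rnorm x <= M.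
Proof. by move=> M0 /(l2_bound_sqr M0)[]. Qed.

Lemma l2_sumE (I : Type) (s : seq I) (u : I -> l2 J V) (j : J) :
  (\sum_(i <- s) u i) j = \sum_(i <- s) u i j.
Proof.
elim: s => [|i s IH]; first by rewrite !big_nil.
by rewrite !big_cons -IH.
Qed.

Definition l2_trunc x (F : {fset J}) : l2 J V := \sum_(j <- F) l2_single j (x j).

Lemma l2_truncE x F j : l2_trunc x F j = if j \in F then x j else 0.
Proof.
rewrite l2_sumE /=; case: ifPn => [jF|/negP jF].
  rewrite (big_fsetD1 j)//= eqxx big1_fset ?addr0// => i.
  by rewrite !inE eq_sym => /andP[/negPf-> _].
rewrite big1_fset// => i iF _; case: eqP => // ji.
by rewrite ji iF in jF.
Qed.

(** Density of the finitely supported families: the squared norm of [x - l2_trunc x F] is controlled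
    by tails of a convergent sum. *)
Lemma cvg_l2_trunc x : l2_trunc x @ totally --> x.
Proof.
apply/cvg_rnormP => e e0.
have [//||F0 hF0] := @summable_tail R J (fun j => rnorm (x j) ^+ 2) _ _ (sum_le_l2norm x)
  ((e / 2) ^+ 2); first by move=> j; exact: sqr_ge0.
  by rewrite exprn_gt0// divr_gt0.
apply: filterS (near_totally F0) => F F0F.
(* [rnorm_l2_le] only yields a weak inequality; halving [e] makes it strict. *)
apply: (@le_lt_trans _ _ (e / 2)); last by lra.
apply: rnorm_l2_le => [|G]; first by rewrite ltW// divr_gt0.
apply: le_trans (ltW (hF0 F G F0F)).
rewrite -(big_fset_incl _ (fsubsetDl G F)) => [|j jG]; last first.
  rewrite !inE jG andbT negbK => jF; rewrite -[(x - _) j]/(x j - l2_trunc x F j).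
  by rewrite l2_truncE jF subrr rnorm0 expr0n.
rewrite big_seq [leRHS]big_seq; apply: ler_sum => j; rewrite !inE => /andP[/negPf jF _].
by rewrite -[(x - _) j]/(x j - l2_trunc x F j) l2_truncE jF subr0.
Qed.

Lemma cvg_l2_coord (T : Type) (F : set_system T) {FF : Filter F} (f : T -> l2 J V)
    x j : f @ F --> x -> (fun t => f t j) @ F --> x j.
Proof.
move=> /cvg_rnormP h; apply/cvg_rnormP => e /h; apply: filterS => t.
apply: le_lt_trans; rewrite -ler_sqr ?nnegrE ?rnorm_ge0//.
by apply: le_trans (sum_le_l2norm (x - f t) [fset j]%fset); rewrite big_seq_fset1.
Qed.

End L2.

(** * Row and column estimates, and the operator of the Schur product *)

Section SchurProduct.
Variables (R : realType) (H : hilbertType R) (J : choiceType).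
Implicit Types (K L S : J -> J -> bop H H) (C : R).

(** The left-hand sum is the quadratic form at [y] of the operator whose norm the row bound
    controls. *)
Lemma row_bound_adjoint K C : row_bound K C -> forall i (F : {fset J}) (y : H),
  \sum_(j <- F) rnorm (adjoint (K i j) y) ^+ 2 <= C ^+ 2 * rnorm y ^+ 2.
Proof.
move=> [_ KC] i F y.
have -> : \sum_(j <- F) rnorm (adjoint (K i j) y) ^+ 2 =
          rdot ((\sum_(j <- F) bop_comp (K i j) (adjoint (K i j))) y) y.
  rewrite bop_sumE rdot_suml; apply: eq_bigr => j _.
  by rewrite -rdotxx -rdot_adjoint.
apply: le_trans (rdot_rnorm _ _) _; rewrite expr2 mulrA ler_wpM2r ?rnorm_ge0//.
by apply: le_trans (rnorm_bop_le _ _) _; rewrite ler_wpM2r ?rnorm_ge0.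
Qed.

Lemma col_bound_sum L C : col_bound L C -> forall j (F : {fset J}) (x : H),
  \sum_(i <- F) rnorm (L i j x) ^+ 2 <= C ^+ 2 * rnorm x ^+ 2.
Proof.
move=> [_ LC] j F x.
have -> : \sum_(i <- F) rnorm (L i j x) ^+ 2 =
          rdot ((\sum_(i <- F) bop_comp (adjoint (L i j)) (L i j)) x) x.
  rewrite bop_sumE rdot_suml; apply: eq_bigr => i _.
  by rewrite -rdotxx rdot_adjoint rdotC.
apply: le_trans (rdot_rnorm _ _) _; rewrite expr2 mulrA ler_wpM2r ?rnorm_ge0//.
by apply: le_trans (rnorm_bop_le _ _) _; rewrite ler_wpM2r ?rnorm_ge0.
Qed.

Lemma row_bound_sum K C : row_bound K C -> forall i (F : {fset J}) (z : J -> H),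
  rnorm (\sum_(j <- F) K i j (z j)) ^+ 2 <= C ^+ 2 * \sum_(j <- F) rnorm (z j) ^+ 2.
Proof.
move=> KC i F z; set y := \sum_(j <- F) _; set Y := rnorm y ^+ 2.
pose b j := rnorm (adjoint (K i j) y); pose a j := rnorm (z j).
have bY : \sum_(j <- F) b j ^+ 2 <= C ^+ 2 * Y by exact: row_bound_adjoint.
have Yab : Y <= \sum_(j <- F) a j * b j.
  rewrite /Y -rdotxx {1}/y rdot_suml; apply: ler_sum => j _.
  by rewrite rdot_adjoint; exact: rdot_rnorm.
(* The main case cancels a factor [C ^+ 2]; for [C = 0] every [b j] vanishes instead. *)
have [C0|C0] := eqVneq C 0.
  apply: le_trans Yab _; rewrite C0 expr0n mul0r big1_fset// => j jF _.
  move: bY; rewrite C0 expr0n mul0r (big_fsetD1 j)//= => h.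
  have : 0 <= \sum_(k <- (F `\ j)%fset) b k ^+ 2.
    by apply: sumr_ge0 => k _; exact: sqr_ge0.
  have b2 := sqr_ge0 (b j) => h2.
  have /eqP : b j ^+ 2 = 0 by lra.
  by rewrite sqrf_eq0 => /eqP->; rewrite mulr0.
have C2 : 0 < C ^+ 2 by rewrite exprn_even_gt0.
rewrite -(ler_pM2l C2).
(* Weighted arithmetic-geometric mean inequality in place of Cauchy-Schwarz: the weight makes the
   sum of [b j ^+ 2] at most [C ^+ 2 * Y], which is absorbed on the left. *)
have : 2 * (C ^+ 2 * \sum_(j <- F) a j * b j) <=
       C ^+ 2 * (C ^+ 2 * \sum_(j <- F) a j ^+ 2) + \sum_(j <- F) b j ^+ 2.
  rewrite !mulr_sumr -big_split /=; apply: ler_sum => j _.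
  by have := sqr_ge0 (C ^+ 2 * a j - b j); rewrite sqrrB; lra.
have : C ^+ 2 * Y <= C ^+ 2 * \sum_(j <- F) a j * b j by rewrite ler_wpM2l// ltW.
lra.
Qed.

(** The row bound is used for each [i]; after exchanging the sums the column bound is used for each
    [j]. Neither constant depends on [F] or [G]. *)
Lemma schur_partial_sum K L C D : row_bound K C -> col_bound L D ->
  forall (F G : {fset J}) (x : l2 J H),
  \sum_(i <- G) rnorm (\sum_(j <- F) schur_mul K L i j (x j)) ^+ 2 <=
    (C * D * rnorm x) ^+ 2.
Proof.
move=> KC LD F G x.
apply: (@le_trans _ _ (\sum_(i <- G) C ^+ 2 * \sum_(j <- F) rnorm (L i j (x j)) ^+ 2)).
  by apply: ler_sum => i _; exact: row_bound_sum KC i F (fun j => L i j (x j)).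
rewrite -mulr_sumr exchange_big /= !exprMn -mulrA ler_wpM2l ?sqr_ge0//.
apply: (@le_trans _ _ (\sum_(j <- F) D ^+ 2 * rnorm (x j) ^+ 2)).
  by apply: ler_sum => j _; exact: col_bound_sum.
by rewrite -mulr_sumr ler_wpM2l ?sqr_ge0// sum_le_l2norm.
Qed.

(** The column bound on the one-element set of [i] makes [rnorm (L i j (x j)) ^+ 2] summable over
    [j]; [row_bound_sum] on tails then gives the Cauchy property. *)
Lemma schur_row_cvg K L C D : row_bound K C -> col_bound L D ->
  forall (x : l2 J H) (i : J),
  cvg ((fun F : {fset J} => \sum_(j <- F) schur_mul K L i j (x j)) @ totally).
Proof.
move=> KC LD x i.
have Lx0 j : 0 <= rnorm (L i j (x j)) ^+ 2 by exact: sqr_ge0.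
have LxM (F : {fset J}) :
    \sum_(j <- F) rnorm (L i j (x j)) ^+ 2 <= D ^+ 2 * rnorm x ^+ 2.
  apply: (@le_trans _ _ (\sum_(j <- F) D ^+ 2 * rnorm (x j) ^+ 2)).
    apply: ler_sum => j _.
    by have := col_bound_sum LD j [fset i]%fset (x j); rewrite big_seq_fset1.
  by rewrite -mulr_sumr ler_wpM2l ?sqr_ge0// sum_le_l2norm.
apply: cauchy_rnorm_cvg => e e0.
have C1 : 0 < C ^+ 2 + 1 by have := sqr_ge0 C; lra.
have d0 : 0 < e ^+ 2 / (C ^+ 2 + 1) by rewrite divr_gt0// exprn_gt0.
have [F0 hF0] := summable_tail Lx0 LxM d0.
exists (\sum_(j <- F0) schur_mul K L i j (x j)).
apply: (filterS _ (near_totally F0)) => F F0F /=.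
rewrite (big_fset_split _ F0F) opprD addNKr rnormN.
rewrite -ltr_sqr ?nnegrE ?rnorm_ge0 ?ltW//.
apply: le_lt_trans (row_bound_sum KC i _ (fun j => L i j (x j))) _.
have := hF0 F0 F (fsubset_refl F0); rewrite ltr_pdivlMr//.
have : 0 <= \sum_(j <- (F `\` F0)%fset) rnorm (L i j (x j)) ^+ 2.
  by apply: sumr_ge0.
lra.
Qed.

(** The uniform bound passes to the limit in [F] because [G] is finite. It serves both the existence
    of the operator and its norm estimate. *)
Lemma schur_limit_bound K L C D : row_bound K C -> col_bound L D ->
  forall (x : l2 J H) (f : J -> H),
  (forall i, (fun F : {fset J} => \sum_(j <- F) schur_mul K L i j (x j)) @ totally
     --> f i) ->
  forall G : {fset J}, \sum_(i <- G) rnorm (f i) ^+ 2 <= (C * D * rnorm x) ^+ 2.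
Proof.
move=> KC LD x f cf G.
have cG : (fun F : {fset J} =>
    \sum_(i <- G) rnorm (\sum_(j <- F) schur_mul K L i j (x j)) ^+ 2) @ totally -->
    \sum_(i <- G) rnorm (f i) ^+ 2.
  apply: cvg_big => [|i _]; first exact: add_continuous.
  by rewrite expr2; apply: cvgM; exact: cvg_rnorm.
by apply: cvgr_to_le cG _; apply: nearW => F; exact: schur_partial_sum.
Qed.

Lemma schur_mul_bounded K L C D : row_bound K C -> col_bound L D ->
  mx_bounded (schur_mul K L).
Proof.
move=> KC LD; have CD0 : 0 <= C * D by rewrite mulr_ge0 ?KC.1 ?LD.1.
pose f (x : l2 J H) i :=
  lim ((fun F : {fset J} => \sum_(j <- F) schur_mul K L i j (x j)) @ totally).
have cf (x : l2 J H) i : (fun F : {fset J} => \sum_(j <- F) schur_mul K L i j (x j)) @ totally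
    --> f x i by exact: schur_row_cvg KC LD x i.
have fb x := l2_bound_sqr (mulr_ge0 CD0 (rnorm_ge0 x))
  (schur_limit_bound KC LD (cf x)).
pose T x := L2 (fb x).1.
have lT : linear T.
  move=> a x y; apply: val_inj; apply/funext => i /=.
  apply: (norm_cvg_unique (cf _ i)).
  rewrite [X in X @ totally](_ : _ = fun F : {fset J} =>
      a *: (\sum_(j <- F) schur_mul K L i j (x j)) +
      \sum_(j <- F) schur_mul K L i j (y j)).
    by apply: cvgD (cf y i); apply: cvgZ (cf x i); exact: cvg_cst.
  apply/funext => F; rewrite scaler_sumr -big_split /=; apply: eq_bigr => j _.
  exact: (bop_linear (schur_mul K L i j) a (x j) (y j)).
have TM x : rnorm (T x) <= C * D * rnorm x by exact: (fb x).2.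
exists (Bop (bounded_bop_pred lT TM)) => i j v /=.
(* On [l2_single j v] the partial sums are constant as soon as [F] contains [j]. *)
apply: (norm_cvg_unique (cf _ i)); apply: cvg_near_cst.
apply: filterS (near_totally [fset j]%fset) => F; rewrite fsub1set => jF.
rewrite (big_fsetD1 j)//= eqxx big1_fset ?addr0// => k.
by rewrite !inE => /andP[/negPf-> _] _; rewrite !linear0.
Qed.

(** Stated for every representing [T], so it covers the one picked by [mx_op]. Continuity of [T]
    along truncations identifies each coordinate of [T x] with the limit of the row sums. *)
Lemma represents_le K L C D (T : bop (l2 J H) (l2 J H)) :
  row_bound K C -> col_bound L D -> represents (schur_mul K L) T ->
  opnorm T <= C * D.
Proof.
move=> KC LD KLT; have CD0 : 0 <= C * D by rewrite mulr_ge0 ?KC.1 ?LD.1.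
apply: opnorm_le => // x; apply: rnorm_l2_le => [|G].
  by rewrite mulr_ge0 ?rnorm_ge0.
apply: (schur_limit_bound KC LD) => i.
have cT : (fun F => T (l2_trunc x F)) @ totally --> T x.
  by apply: continuous_cvg; [exact: bop_continuous|exact: cvg_l2_trunc].
rewrite [X in X @ totally](_ : _ = fun F => T (l2_trunc x F) i).
  exact: cvg_l2_coord cT.
apply/funext => F; rewrite linear_sum l2_sumE; apply: eq_bigr => j _.
by rewrite -KLT.
Qed.

(** The infimum is itself a bound: the square root of each positive [opnorm] involved lies below
    every admissible [C]. *)
Lemma row_norm_bound K : row_bounded K -> row_bound K (row_norm K).
Proof.
move=> [C0 KC0]; have ne : [set C | row_bound K C] !=set0 by exists C0.
have r0 : 0 <= row_norm K by apply: lb_le_inf => // C [].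
split=> // i F; set a := opnorm _; have [a0|a0] := leP a 0.
  by apply: le_trans a0 _; exact: sqr_ge0.
rewrite -(sqr_sqrtr (ltW a0)) ler_sqr ?nnegrE ?sqrtr_ge0//.
apply: lb_le_inf => // C [C00 KC].
by rewrite -[leRHS]ger0_norm// -sqrtr_sqr ler_wsqrtr//; exact: KC.
Qed.

Lemma col_norm_bound L : col_bounded L -> col_bound L (col_norm L).
Proof.
move=> [C0 LC0]; have ne : [set C | col_bound L C] !=set0 by exists C0.
have r0 : 0 <= col_norm L by apply: lb_le_inf => // C [].
split=> // j F; set a := opnorm _; have [a0|a0] := leP a 0.
  by apply: le_trans a0 _; exact: sqr_ge0.
rewrite -(sqr_sqrtr (ltW a0)) ler_sqr ?nnegrE ?sqrtr_ge0//.
apply: lb_le_inf => // C [C00 LC].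
by rewrite -[leRHS]ger0_norm// -sqrtr_sqr ler_wsqrtr//; exact: LC.
Qed.

End SchurProduct.

Theorem theorem2p2 (R : realType) (H : hilbertType R) (J : choiceType)
    (K L : J -> J -> bop H H) :
  row_bounded K -> col_bounded L ->
  mx_bounded (schur_mul K L) /\
  mx_norm (schur_mul K L) <= row_norm K * col_norm L.
Proof.
move=> /row_norm_bound KC /col_norm_bound LD.
have KLb := schur_mul_bounded KC LD.
split=> //; apply: represents_le KC LD _.
(* Boundedness of the product excludes the default value of [mx_op]. *)
rewrite /mx_op; case: xgetP => [T -> //|noT].
by have [T /noT] := KLb.
Qed.
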